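(* In the auction for substitutable and complementary resources described in the context ($N$ users, $M$ resources split into $G$ groups), a mechanism $(p,c)$ is individually rational and incentive compatible, i.e. $u_i(t_i)\ge 0$ and $u_i(t_i)\ge \hat u_i(\hat t_i|t_i)$ for every user $i\in\{1,\dots,N\}$ and all $t_i,\hat t_i\in[\underline{t_i},\overline{t_i}]$, if and only if the following three conditions hold for every $i\in\{1,\dots,N\}$ and all $t_i,\hat t_i\in[\underline{t_i},\overline{t_i}]$: (1) $$u_i(\underline{t_i})\ge 0;$$ (2) $$u_i(t_i)=u_i(\underline{t_i})+\mathbb{E}_{\mathbf{t}_{-i}}\Big\{\sum_{j=1}^{M}\int_{\underline{t_i}}^{t_i}\frac{\partial v_{ij}(x,\mathbf{t}_{-i})}{\partial t_i}\,p_{ij}(x,\mathbf{t}_{-i})\,dx\Big\};$$ (3) $$\mathbb{E}_{\mathbf{t}_{-i}}\Big\{\sum_{j=1}^{M}\int_{\hat t_i}^{t_i}\frac{\partial v_{ij}(x,\mathbf{t}_{-i})}{\partial t_i}\,p_{ij}(x,\mathbf{t}_{-i})\,dx\Big\}\ \ge\ \mathbb{E}_{\mathbf{t}_{-i}}\Big\{\sum_{j=1}^{M}\big(v_{ij}(t_i,\mathbf{t}_{-i})-v_{ij}(\hat t_i,\mathbf{t}_{-i})\big)\,p_{ij}(\hat t_i,\mathbf{t}_{-i})\Big\}.$$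
   Context: Setting. There are $N$ users (buyers) and one service provider (seller) with $M$ resources, divided into $G$ groups; group $k$ contains $M_k$ resources, $M_1+\dots+M_G=M$, and consists of the resources with indices $j$ from $\sum_{n=1}^{k-1}M_n+1$ to $\sum_{n=1}^{k}M_n$. Resources in the same group are substitutable and resources in different groups are complementary. User $i$ has a private type $t_i\in[\underline{t_i},\overline{t_i}]$, a random variable with CDF $F(t_i)$ and PDF $f(t_i)$ known to the service provider. Write $\mathbf{t}=(t_1,\dots,t_N)=(t_i,\mathbf{t}_{-i})$, where $\mathbf{t}_{-i}$ is the vector of types of the users other than $i$, and let $\mathbb{E}_{\mathbf{t}_{-i}}$ be expectation over $\mathbf{t}_{-i}$. Valuations. $v_{ij}(t_i,\mathbf{t}_{-i})$ is the valuation of user $i$ for resource $j$. It is assumed positive, non-decreasing and concave with respect to $t_i$; $\frac{\partial v_{ij}(x,\mathbf{t}_{-i})}{\partial t_i}$ denotes the partial derivative in the own-type argument evaluated at $t_i=x$. Mechanism. A mechanism is a pair $(p,c)$: $p$ is the set of all $p_{ij}$, where $p_{ij}(t_i,\mathbf{t}_{-i})$ is the proportion of resource $j$ allocated to user $i$ when the reported types are $(t_i,\mathbf{t}_{-i})$ (so $p_{ij}\ge 0$ and $\sum_{i=1}^N p_{ij}\le 1$ for each $j$), and $c=\{c_1,\dots,c_N\}$, where $c_i(t_i)$ is the cost charged by the service provider to user $i$. Premium and discount term. With premium factor $h_i(t_i)$ and discount factor $l_i(t_i)$ of user $i$, $$S_i(t_i,\mathbf{t}_{-i})=h_i(t_i)\prod_{k=1}^{G}\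 \sum_{j=\sum_{n=1}^{k-1}M_n+1}^{\sum_{n=1}^{k}M_n}p_{ij}(t_i,\mathbf{t}_{-i})\;-\;l_i(t_i)\sum_{j=1}^{M}p_{ij}(t_i,\mathbf{t}_{-i}).$$ Utilities. The expected utility of user $i$ of type $t_i$ submitting true valuations is $$u_i(t_i)=\mathbb{E}_{\mathbf{t}_{-i}}\Big\{\sum_{j=1}^{M}p_{ij}(t_i,\mathbf{t}_{-i})v_{ij}(t_i,\mathbf{t}_{-i})+S_i(t_i,\mathbf{t}_{-i})\Big\}-c_i(t_i),$$ and the expected utility of user $i$ of true type $t_i$ submitting valuations as if of type $\hat t_i$ is $$\hat u_i(\hat t_i|t_i)=\mathbb{E}_{\mathbf{t}_{-i}}\Big\{\sum_{j=1}^{M}p_{ij}(\hat t_i,\mathbf{t}_{-i})v_{ij}(t_i,\mathbf{t}_{-i})+S_i(\hat t_i,\mathbf{t}_{-i})\Big\}-c_i(\hat t_i).$$ *)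

(* Defs.v *)
From HB Require Import structures.
From mathcomp Require Export all_boot all_order all_algebra.
From mathcomp Require Export all_classical all_reals all_analysis.

Set Implicit Arguments.
Unset Strict Implicit.
Unset Printing Implicit Defensive.

Export Order.TTheory GRing.Theory Num.Theory.
Export numFieldNormedType.Exports.

Global Open Scope classical_set_scope.
Global Open Scope ring_scope.

(* \int_a^b f with the usual sign convention when b < a; this matters because
   both orderings of the true and the reported type occur. *)
Definition oriented_integral (R : realType) (a b : R) (f : R -> R) : R :=
  if a <= b then \int[lebesgue_measure]_(x in `[a, b]) f x
  else - \int[lebesgue_measure]_(x in `[b, a]) f x.

Section Types.
Context {R : realType} {N : nat}.

Definition type_space (lo hi : 'I_N -> R) : set (N.-tuple R) :=
  [set t | forall k, tnth t k \in `[lo k, hi k]].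

(* The profile (x, t_{-i}). *)
Definition with_type (i : 'I_N) (x : R) (t : N.-tuple R) : N.-tuple R :=
  [tuple if k == i then x else tnth t k | k < N].

Context {d : measure_display} {Omega : measurableType d}
        {P : probability Omega R}.

Record has_cdf_pdf (X : {RV P >-> R}) (F f : R -> R) : Prop := {
  cdf_spec : forall x, cdf X x = (F x)%:E ;
  pdf_measurable : measurable_fun setT f ;
  pdf_ge0 : forall x, 0 <= f x ;
  pdf_spec : forall A : set R, measurable A ->
    distribution P X A = (\int[lebesgue_measure]_(x in A) (f x)%:E)%E }.

Definition type_profile (tau : 'I_N -> {RV P >-> R}) (w : Omega) : N.-tuple R :=
  [tuple tau k w | k < N].

(* E_{t_{-i}} { g (x, t_{-i}) } is written E_others tau (fun t => g (with_type i x t)):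
   the i-th coordinate of the random profile is overwritten in g, so only the
   law of the other users' types matters. *)
Definition E_others (tau : 'I_N -> {RV P >-> R}) (g : N.-tuple R -> R) : \bar R :=
  'E_P[fun w => g (type_profile tau w)].

End Types.

Section Auction.
Context {R : realType} {N M G : nat}.
Implicit Types (lo hi : 'I_N -> R) (i : 'I_N) (j : 'I_M) (t : N.-tuple R)
  (v p : 'I_N -> 'I_M -> N.-tuple R -> R) (m : 'I_G -> nat)
  (h l c : 'I_N -> R -> R).

Definition own_valuation v i j t : R -> R := fun x => v i j (with_type i x t).

(* \partial v_ij (x, t_{-i}) / \partial t_i *)
Definition own_derivative v i j t (x : R) : R := derive1 (own_valuation v i j t) x.

Record valuation_profile lo hi v : Prop := {
  valuation_gt0 : forall i j t, type_space lo hi t -> 0 < v i j t ;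
  valuation_nondecreasing : forall i j t, type_space lo hi t ->
    {in `[lo i, hi i] &, {homo own_valuation v i j t : x y / x <= y}} ;
  valuation_concave : forall i j t, type_space lo hi t ->
    convex_function (`[lo i, hi i]%classic : set R^o)
      (fun x => - own_valuation v i j t x) }.

(* What is needed for the partial derivatives and the expectations to exist.
   Differentiability at the two endpoints is not required, only continuity:
   the derivative is used exclusively under an integral over x. *)
Record regular_valuation {d : measure_display} {Omega : measurableType d}
    {P : probability Omega R} (tau : 'I_N -> {RV P >-> R}) lo hi v : Prop := {
  valuation_measurable : forall i j, measurable_fun (type_space lo hi) (v i j) ;
  valuation_derivable : forall i j t, type_space lo hi t ->
    derivable_oo_LRcontinuous (own_valuation v i j t) (lo i) (hi i) ;
  valuation_integrable : forall i j x, x \in `[lo i, hi i] ->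
    P.-integrable setT
      (fun w => (own_valuation v i j (type_profile tau w) x)%:E) }.

Record allocation lo hi p : Prop := {
  allocation_ge0 : forall i j t, type_space lo hi t -> 0 <= p i j t ;
  allocation_le1 : forall j t, type_space lo hi t -> \sum_(i < N) p i j t <= 1 ;
  allocation_measurable : forall i j, measurable_fun (type_space lo hi) (p i j) }.

(* Groups are consecutive blocks of resources; both groups and resources are
   numbered from 0, whence the half-open interval. *)
Definition in_group m (k : 'I_G) j : bool :=
  (\sum_(n < G | (n < k)%N) m n <= j < \sum_(n < G | (n <= k)%N) m n)%N.

Definition premium_discount m h l p i t : R :=
  h i (tnth t i) * (\prod_(k < G) \sum_(j < M | in_group m k j) p i j t)
  - l i (tnth t i) * \sum_(j < M) p i j t.

Context {d : measure_display} {Omega : measurableType d}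
        {P : probability Omega R}.
Implicit Type tau : 'I_N -> {RV P >-> R}.
Local Open Scope ereal_scope.

(* \hat u_i (y | x): true type x, reported type y. *)
Definition deviation_utility tau v m h l p c i (y x : R) : \bar R :=
  E_others tau (fun t =>
    (\sum_(j < M) p i j (with_type i y t) * v i j (with_type i x t)
     + premium_discount m h l p i (with_type i y t))%R)
  - (c i y)%:E.

Definition utility tau v m h l p c i (x : R) : \bar R :=
  E_others tau (fun t =>
    (\sum_(j < M) p i j (with_type i x t) * v i j (with_type i x t)
     + premium_discount m h l p i (with_type i x t))%R)
  - (c i x)%:E.

Definition individually_rational tau lo hi v m h l p c : Prop :=
  forall i x, x \in `[lo i, hi i] -> 0 <= utility tau v m h l p c i x.

Definition incentive_compatible tau lo hi v m h l p c : Prop :=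
  forall i x y, x \in `[lo i, hi i] -> y \in `[lo i, hi i] ->
    deviation_utility tau v m h l p c i y x <= utility tau v m h l p c i x.

(* E_{t_{-i}} { \sum_j \int_a^b (\partial v_ij (x, t_{-i}) / \partial t_i)
   p_ij (x, t_{-i}) dx } *)
Definition expected_information_rent tau v p i (a b : R) : \bar R :=
  E_others tau (fun t =>
    (\sum_(j < M) oriented_integral a b
       (fun x => own_derivative v i j t x * p i j (with_type i x t)))%R).

End Auction.

(* Main.v *)
Require Import Defs.
From mathcomp Require Import all_boot all_order all_algebra.
From mathcomp Require Import all_classical all_reals all_analysis.
From mathcomp Require Import measurable_realfun ring lra.

(* Incentive compatibility says that the utility u of user i satisfies
   u x - u y >= E (sum_j p_ij (y) (v_ij (x) - v_ij (y))) for all types x and y;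
   condition (3) is this inequality once condition (2) has turned u x - u y
   into an expected information rent, so everything rests on deriving (2).
   No differentiability of u is needed for that.  Dividing the inequality by
   x - y = h and letting h -> 0+, Fatou's lemma bounds the rent
   E \int_a^b (sum_j v_ij' p_ij) by u b - u a, because the averaged difference
   quotients of a continuous function W integrate to W b - W a in the limit.
   The same argument with h -> 0- and p_ij replaced by 1 - p_ij bounds
   E \int_a^b (sum_j v_ij' (1 - p_ij)) by (k b - k a) - (u b - u a), where
   k = E (sum_j v_ij).  By concavity the two rents add up to at least
   k b - k a, so both bounds are equalities. *)

Import Order.TTheory GRing.Theory Num.Theory.

Set Implicit Arguments.
Unset Strict Implicit.
Unset Printing Implicit Defensive.

(** * Difference quotients and the limits of their integrals *)

Section DifferenceQuotients.
Context {R : realType}.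
Implicit Types (W : R -> R) (h : R^nat) (a b x : R).
Notation mu := (@lebesgue_measure R).

Definition diff_quotient W (h x : R) : R := (W (x + h) - W x) / h.

Lemma continuous_diff_quotient W (h : R) :
  continuous W -> continuous (diff_quotient W h).
Proof.
move=> cW x; apply: cvgMr_tmp; apply: cvgB; last exact: cW.
apply: continuous_comp; last exact: cW.
by apply: (@cvgD _ _ _ _ _ id); [exact: cvg_id | exact: cvg_cst].
Qed.

Lemma cvg_diff_quotient W x h : derivable W x 1 ->
  h @ \oo --> (0 : R) -> (forall n, h n != 0) ->
  diff_quotient W (h n) x @[n --> \oo] --> derive1 W x.
Proof.
move=> dW h0 hn0; rewrite derive1E.
have /cvgr_dnbhsP/(_ h (conj hn0 h0)) := dW.
apply: cvg_trans; apply: near_eq_cvg; near=> n.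
by rewrite /diff_quotient /= [_ *: 1]mulr1 [x + _]addrC [RHS]mulrC.
Unshelve. all: by end_near. Qed.

(** The integral from [a] is a primitive only to the right of [a], hence the open interval; a use on
    a closed interval first enlarges it. *)
Lemma continuous_primitive W a b : continuous W -> a < b ->
  exists F : R -> R, forall x, x \in `]a, b[ -> is_derive x (1 : R) F (W x).
Proof.
move=> cW ab; exists (fun x => \int[mu]_(t in `[a, x]) W t) => x.
rewrite in_itv/= => /andP[ax xb].
have iW : mu.-integrable `[a, b] (EFin \o W).
  apply: continuous_compact_integrable; first exact: segment_compact.
  exact: continuous_subspaceT.
have [dF F'] := continuous_FTC1_closed xb iW ax (cW x).
by rewrite -F' derive1E; exact: derivableP.
Qed.

(** If [F] is a primitive of [W], then [diff_quotient F] is a primitive of [diff_quotient W]. The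
    integral is therefore the difference of two quotients of [F], which tend to [W b] and [W a]; [W]
    itself is never differentiated. *)
Lemma integral_diff_quotient_cvg W h a b : a < b -> continuous W ->
  h @ \oo --> (0 : R) -> (forall n, h n != 0) ->
  (\int[mu]_(x in `[a, b]) (diff_quotient W (h n) x)%:E)%E @[n --> \oo]
    --> (W b - W a)%:E.
Proof.
move=> ab cW h0 hn0.
(* The margin of 1 on each side keeps [x + h n] in the domain of the primitive as soon as [h n] has
   absolute value below 1. *)
have [|F dF] := @continuous_primitive W (a - 1) (b + 1) cW; first by lra.
have aI : a \in `]a - 1, b + 1[ by rewrite in_itv/=; lra.
have bI : b \in `]a - 1, b + 1[ by rewrite in_itv/=; lra.
have quotW x : x \in `]a - 1, b + 1[ ->
    diff_quotient F (h n) x @[n --> \oo] --> W x.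
  move=> xI; have dFx := dF _ xI.
  by rewrite -(@derive_val _ _ _ _ _ _ _ dFx) -derive1E; exact: cvg_diff_quotient.
suff : (diff_quotient F (h n) b - diff_quotient F (h n) a)%:E @[n --> \oo]
    --> (W b - W a)%:E.
  apply: cvg_trans; apply: near_eq_cvg.
  have /cvgr0Pnorm_lt/(_ 1 ltr01) := h0; apply: filterS => n hn1.
  have {hn1} /andP[hnl hnu] : -1 < h n < 1 by rewrite -ltr_norml.
  have dquot x : x \in `[a, b] ->
      is_derive x (1 : R) (diff_quotient F (h n)) (diff_quotient W (h n) x).
    rewrite in_itv/= => /andP[ax xb].
    have d1 : is_derive (x + h n) (1 : R) F (W (x + h n)).
      by apply: dF; rewrite in_itv/=; lra.
    have d2 : is_derive x (1 : R) F (W x) by apply: dF; rewrite in_itv/=; lra.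
    rewrite /diff_quotient.
    have d3 : is_derive x (1 : R) (F \o (fun y => y + h n)) (W (x + h n)).
      apply: is_derive_eq.
      by rewrite addr0 mulr1.
    have -> : (fun y => (F (y + h n) - F y) / h n) =
       (h n)^-1 *: (F \o (fun y => y + h n) - F).
      by apply/funext => y /=; rewrite mulrC.
    by apply: is_derive_eq; rewrite mulrC.
  rewrite EFinB; apply/esym/continuous_FTC2 => //.
  - apply: continuous_subspaceT => x.
    exact: continuous_diff_quotient.
  - have cq x : x \in `[a, b] -> {for x, continuous (diff_quotient F (h n))}.
      by move=> /dquot[dx _]; apply/differentiable_continuous; rewrite -derivable1_diffP.
    split.
    + by move=> x /subset_itv_oo_cc /dquot[].
    + by apply: cvg_at_right_filter; apply: cq; rewrite in_itv/= lexx ltW.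
    + by apply: cvg_at_left_filter; apply: cq; rewrite in_itv/= lexx ltW.
  - by move=> x /subset_itv_oo_cc /dquot[? dx]; rewrite derive1E.
apply/fine_cvgP; split; first exact: nearW.
by apply: (@cvgB _ _ _ _ _ (fun n => diff_quotient F (h n) b)); exact: quotW.
Unshelve. all: by end_near. Qed.

Lemma le_limn_einf (u w : (\bar R)^nat) : (forall n, (u n <= w n)%E) ->
  (limn_einf u <= limn_einf w)%E.
Proof.
move=> uw; rewrite !limn_einf_lim; apply: lee_lim.
- exact: is_cvg_einfs.
- exact: is_cvg_einfs.
near=> n; apply: le_ereal_inf_tmp => _ [k /= nk <-].
by apply: ge_ereal_inf; exists (u k) => //; exists k.
Unshelve. all: by end_near. Qed.

Lemma limn_einf_ge0 (u : (\bar R)^nat) : (forall n, (0 <= u n)%E) ->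
  (0 <= limn_einf u)%E.
Proof.
move=> u0.
have [<- _] : (limn_einf (fun=> 0) = 0 :> \bar R)%E *
    (limn_esup (fun=> 0) = 0 :> \bar R)%E.
  by apply: cvg_limn_einf_sup; exact: cvg_cst.
exact: le_limn_einf.
Qed.

Lemma diff_quotient_ge0 W (h x : R) : {homo W : x y / x <= y} ->
  0 <= diff_quotient W h x.
Proof.
move=> mW; rewrite /diff_quotient; have [h0|h0] := leP 0 h.
  by rewrite divr_ge0// subr_ge0 mW// lerDl.
apply: mulr_le0; last by rewrite invr_le0 ltW.
by rewrite subr_le0 mW// gerDl ltW.
Qed.

(** Fatou's lemma bounds the integral of the lower limit of the quotients by the limit of their
    integrals. Monotonicity of [W] makes the quotients nonnegative for increments of either sign. *)
Lemma integral_limn_einf_diff_quotient W h a b (D : R -> \bar R) :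
  a <= b -> continuous W -> {homo W : x y / x <= y} ->
  h @ \oo --> (0 : R) -> (forall n, h n != 0) ->
  measurable_fun `[a, b] D -> (forall x, 0 <= D x)%E ->
  (forall x, a <= x <= b ->
    (D x <= limn_einf (fun n => (diff_quotient W (h n) x)%:E))%E) ->
  (\int[mu]_(x in `[a, b]) D x <= (W b - W a)%:E)%E.
Proof.
rewrite le_eqVlt => /predU1P[<-|ab] cW mW h0 hn0 mD D0 DW.
  by rewrite set_itv1 integral_set1 subrr.
have mq n : measurable_fun `[a, b] (fun x => (diff_quotient W (h n) x)%:E).
  apply/measurable_EFinP/measurable_funTS.
  by apply: continuous_measurable_fun; exact: continuous_diff_quotient.
have q0 n x : (0 <= (diff_quotient W (h n) x)%:E)%E.
  by rewrite lee_fin diff_quotient_ge0.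
have [<- _] := cvg_limn_einf_sup (integral_diff_quotient_cvg ab cW h0 hn0).
apply: le_trans (@fatou _ _ _ mu _ _ _ mq (fun n x _ => q0 n x)) => //.
apply: ge0_le_integral => //.
rewrite /limn_einf; apply: measurableT_comp => //.
apply: measurable_fun_limn_esup => n; apply: measurableT_comp => //; exact: mq.
Qed.

End DifferenceQuotients.

(** * Exchanging and splitting iterated integrals *)

Section Tonelli.
Context {R : realType} {d1 d2 : measure_display} {T1 : measurableType d1}
  {T2 : measurableType d2} (m1 : {sigma_finite_measure set T1 -> \bar R})
  (m2 : {sigma_finite_measure set T2 -> \bar R}).
Local Open Scope ereal_scope.

(** Extending [f] by zero off the cylinder over [A] reduces both claims to Tonelli's theorem on the
    whole product. *)
Lemma tonelli_within (A : set T1) (f : T1 * T2 -> \bar R) :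
  measurable A -> measurable_fun setT f -> (forall z, 0 <= f z) ->
  \int[m2]_w \int[m1]_(x in A) f (x, w) = \int[m1]_(x in A) \int[m2]_w f (x, w)
  /\ measurable_fun setT (fun w => \int[m1]_(x in A) f (x, w)).
Proof.
move=> mA mf f0; pose g := f \_ (A `*` setT).
have mAT : measurable (A `*` @setT T2) by exact: measurableX.
have mg : measurable_fun setT g by apply/(measurable_restrictT f mAT)/measurable_funTS.
have g0 z : 0 <= g z by rewrite /g patchE; case: ifPn.
have gE w : \int[m1]_(x in A) f (x, w) = \int[m1]_x g (x, w).
  rewrite integral_mkcond; apply: eq_integral => x _.
  rewrite /g !patchE; congr (if _ then _ else _).
  by apply/idP/idP; rewrite !inE => // -[].
under eq_integral do rewrite gE.
split; last first.
  by under eq_fun do rewrite gE; exact: measurable_fun_fubini_tonelli_G.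
rewrite -fubini_tonelli// [RHS]integral_mkcond; apply: eq_integral => x _.
rewrite patchE; case: ifPn => [|] xA.
  by apply: eq_integral => w _; rewrite /g patchE ifT// inE; split => //; rewrite -inE.
rewrite -[RHS](integral0 m2 setT); apply: eq_integral => w _.
by rewrite /g patchE ifF//; apply/negbTE; apply: contra xA; rewrite !inE => -[].
Qed.

End Tonelli.

(** With the integral over [x] moved outside, this is additivity over a disjoint union for a single
    function of [x]. *)
Lemma integral_itv_split {R : realType} {d : measure_display}
    {T : measurableType d} (m : {sigma_finite_measure set T -> \bar R})
    (f : R * T -> \bar R) (a b c : R) :
  a <= b -> b <= c -> measurable_fun setT f -> (forall z, 0 <= f z)%E ->
  (\int[m]_w \int[lebesgue_measure]_(x in `[a, c]) f (x, w) =
   \int[m]_w \int[lebesgue_measure]_(x in `[a, b]) f (x, w) +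
   \int[m]_w \int[lebesgue_measure]_(x in `[b, c]) f (x, w))%E.
Proof.
move=> ab bc mf f0.
have itvE (x y : R) := (@tonelli_within _ _ _ _ _ lebesgue_measure m _ f
  (measurable_itv `[x, y]) mf f0).1.
rewrite !itvE.
have mF (A : set R) : measurable_fun A (fun x => \int[m]_w f (x, w))%E.
  by apply: measurable_funTS; exact: (measurable_fun_fubini_tonelli_F f mf f0).
(* The second interval loses its left endpoint, a null set, so that [b] is not counted twice. *)
rewrite (@integral_itv_bndoo _ b c _ true false)//.
rewrite -(@integral_itv_bndoo _ b c _ false false)//.
rewrite -ge0_integral_setU//; last 3 first.
- exact: mF.
- by move=> x _; apply: integral_ge0.
- rewrite disj_set2E; apply/eqP/seteqP; split => // x /=.
  by rewrite !in_itv/= => -[/andP[_ xb] /andP[bx _]]; lra.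
congr (integral _ _ _); apply/seteqP; split => x /=; rewrite !in_itv/=.
  by case: (lerP x b) => [xb|bx] /andP[ax xc]; [left|right]; lra.
by case=> /andP[? ?]; lra.
Qed.

(** * The envelope identity for one user, with types extended to the whole real line *)

Section Envelope.
Context {R : realType} {d : measure_display} {Omega : measurableType d}
  (P : probability Omega R) {M : nat} (lo hi : R).
Variables (V DV Q : 'I_M -> R -> Omega -> R) (U : R -> R).
Notation mu := (@lebesgue_measure R).
Implicit Types q : 'I_M -> R -> Omega -> R.

Definition jointly_measurable q :=
  forall j, measurable_fun setT (fun z : R * Omega => q j z.1 z.2).

Definition fractional q := forall j x w, 0 <= q j x w <= 1.

(** How much more type [x] than type [y] values the shares given to report [y]. Premium, discount
    and payment depend on the report alone and cancel in this comparison. *)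
Definition gain q (y x : R) (w : Omega) : R :=
  \sum_(j < M) q j y w * (V j x w - V j y w).

Hypotheses (mV : jointly_measurable V) (mDV : jointly_measurable DV)
  (mQ : jointly_measurable Q) (Q01 : fractional Q).
Hypothesis V_ge0 : forall j x w, 0 <= V j x w.
Hypothesis V_le : forall j x w, V j x w <= V j hi w.
Hypothesis V_homo : forall j w, {homo (fun x => V j x w) : x y / x <= y}.
Hypothesis V_continuous : forall j w, continuous (fun x => V j x w).
Hypothesis V_integrable : forall j x, P.-integrable setT (EFin \o V j x).
Hypothesis DV_ge0 : forall j x w, 0 <= DV j x w.
Hypothesis DV_out : forall j x w, ~~ (lo < x < hi) -> DV j x w = 0.
Hypothesis V_derivable : forall j x w, lo < x < hi ->
  derivable (fun y => V j y w) x 1.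
Hypothesis DV_derive : forall j x w, lo < x < hi ->
  DV j x w = derive1 (fun y => V j y w) x.
Hypothesis V_tangent : forall j x y w, lo < x < hi -> x <= y ->
  V j y w - V j x w <= DV j x w * (y - x).
Hypothesis U_gain : forall x y, \int[P]_w gain Q y x w <= U x - U y.

Lemma jointly_measurable_section q j x :
  jointly_measurable q -> measurable_fun setT (q j x).
Proof.
move=> mq; exact: (measurableT_comp (mq j) (@pair1_measurable _ _ _ _ x)).
Qed.

Lemma measurable_gain q y x : jointly_measurable q ->
  measurable_fun setT (gain q y x).
Proof.
move=> mq; apply: measurable_sum => j; apply: measurable_funM.
  exact: jointly_measurable_section.
by apply: measurable_funB; exact: jointly_measurable_section.
Qed.

(** Shares lie between 0 and 1, so the sum of the valuations at [x] and at [y] is an integrable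
    majorant. *)
Lemma integrable_gain q y x : jointly_measurable q -> fractional q ->
  P.-integrable setT (EFin \o gain q y x).
Proof.
move=> mq q01.
apply: (@le_integrable _ _ _ P _ measurableT _
  (fun w => \sum_(j < M) ((V j x w)%:E + (V j y w)%:E))%E).
- by apply/measurable_EFinP; exact: measurable_gain.
- move=> w _; under eq_bigr do rewrite -EFinD.
  rewrite sumEFin !abse_EFin lee_fin [leRHS]ger0_norm; last first.
    by apply: sumr_ge0 => j _; rewrite addr_ge0.
  apply: le_trans (ler_norm_sum _ _ _) _; apply: ler_sum => j _.
  have /andP[q0 q1] := q01 j y w.
  rewrite normrM ger0_norm// -[leRHS]mul1r ler_pM//.
  by rewrite (le_trans (ler_normB _ _))// !ger0_norm.
- apply: integrable_sum => // j _; apply: integrableD => //; exact: V_integrable.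
Qed.

(** Shared core of the two rent bounds. Fatou's lemma is applied twice: over [w], to pass from
    expected quotients to the expected marginal gain at a fixed [x], and then over [x]. The sign of
    [h] is left open because the two uses take opposite signs. *)
Lemma integral_marginal_gain_le q W h a b :
  a <= b -> continuous W -> {homo W : x y / x <= y} ->
  h @ \oo --> (0 : R) -> (forall n, h n != 0) ->
  jointly_measurable q -> fractional q ->
  (forall x n, \int[P]_w (gain q x (x + h n) w / h n) <= diff_quotient W (h n) x) ->
  (\int[P]_w \int[mu]_(x in `[a, b]) (\sum_(j < M) q j x w * DV j x w)%:E
    <= (W b - W a)%:E)%E.
Proof.
move=> ab cW mW h0 hn0 mq q01 gW.
pose f (z : R * Omega) := (\sum_(j < M) q j z.1 z.2 * DV j z.1 z.2)%:E.
have mf : measurable_fun setT f.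
  by apply/measurable_EFinP; apply: measurable_sum => j; exact: measurable_funM.
have f0 z : (0 <= f z)%E.
  rewrite lee_fin; apply: sumr_ge0 => j _; rewrite mulr_ge0//.
  by have /andP[] := q01 j z.1 z.2.
have [+ _] := @tonelli_within _ _ _ _ _ mu P _ f (measurable_itv `[a, b]) mf f0.
rewrite /f /= => ->.
apply: (@integral_limn_einf_diff_quotient _ W h) => //.
- by apply: measurable_funTS; exact: (measurable_fun_fubini_tonelli_F f mf f0).
- by move=> x; apply: integral_ge0 => w _; exact: (f0 (x, w)).
(* Off the open interval [DV] vanishes, and nonnegativity of the quotients of [W] suffices. *)
move=> x _; have [xI|xI] := boolP (lo < x < hi); last first.
  under eq_integral do under eq_bigr do rewrite DV_out// mulr0.
  rewrite integral0_eq => [|w _]; last by rewrite big1.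
  by apply: limn_einf_ge0 => n; rewrite lee_fin diff_quotient_ge0.
have gE n w : gain q x (x + h n) w / h n =
    \sum_(j < M) q j x w * diff_quotient (fun y => V j y w) (h n) x.
  by rewrite /gain mulr_suml; apply: eq_bigr => j _; rewrite mulrA.
have g0 n w : (0 <= (gain q x (x + h n) w / h n)%:E)%E.
  rewrite lee_fin gE; apply: sumr_ge0 => j _; rewrite mulr_ge0//.
    by have /andP[] := q01 j x w.
  by rewrite diff_quotient_ge0//; exact: V_homo.
have mg n : measurable_fun setT (fun w => (gain q x (x + h n) w / h n)%:E).
  apply/measurable_EFinP; apply: measurable_funM => //.
  exact: measurable_gain.
(* At an interior type every valuation is derivable, so the lower limit is a genuine limit. *)
have limg w : limn_einf (fun n => (gain q x (x + h n) w / h n)%:E) =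
    (\sum_(j < M) q j x w * DV j x w)%:E.
  apply: (cvg_limn_einf_sup _).1; apply/fine_cvgP; split; first exact: nearW.
  rewrite /comp /=; under eq_cvg do rewrite gE.
  apply: cvg_big => [|j _]; first by move=> z; exact: add_continuous.
  apply: cvgMl_tmp; rewrite DV_derive//; apply: cvg_diff_quotient => //.
  exact: V_derivable.
under eq_integral do rewrite -limg.
apply: le_trans (@fatou _ _ _ P _ measurableT _ mg (fun n w _ => g0 n w)) _.
apply: le_limn_einf => n; have := gW x n; rewrite -lee_fin; apply: le_trans.
rewrite fineK//.
apply: integrable_fin_num => //.
have := integrableZr measurableT (h n)^-1 (integrable_gain x (x + h n) mq q01).
by apply: eq_integrable.
Qed.

(** * Mean valuation, complementary shares and continuity of the utility *)

Definition mean_valuation (x : R) : R := \int[P]_w \sum_(j < M) V j x w.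

Lemma integrable_sum_valuation x :
  P.-integrable setT (fun w => (\sum_(j < M) V j x w)%:E).
Proof.
under eq_fun do rewrite -sumEFin.
by apply: integrable_sum => // j _; exact: V_integrable.
Qed.

(** Continuity under the integral sign; by [V_le] the valuations at the top type [hi] dominate those
    at every real argument. *)
Lemma continuous_mean_valuation : continuous mean_valuation.
Proof.
move=> x; have xI : x \in `]x - 1, x + 1[%classic by rewrite inE/= in_itv/=; lra.
apply: (@continuity_under_integral _ _ _ P (fun x w => \sum_(j < M) V j x w) _
  measurableT (x - 1) (x + 1) _ _ (fun w => \sum_(j < M) V j hi w)) => //.
- by move=> y _; exact: integrable_sum_valuation.
- apply: aeW => w _ y _; apply: cvg_big => [|j _]; last exact: V_continuous.
  by move=> z; exact: add_continuous.
- exact: integrable_sum_valuation.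
- move=> y _; apply: aeW => w _; rewrite ger0_norm.
    by apply: ler_sum => j _; exact: V_le.
  by apply: sumr_ge0 => j _; exact: V_ge0.
Qed.

Lemma gain_le0 q y x w : fractional q -> x <= y -> gain q y x w <= 0.
Proof.
move=> q01 xy; apply: sumr_le0 => j _; rewrite mulr_ge0_le0 ?subr_le0 ?V_homo//.
by have /andP[] := q01 j y w.
Qed.

Lemma gain_ge0 q y x w : fractional q -> y <= x -> 0 <= gain q y x w.
Proof.
move=> q01 yx; apply: sumr_ge0 => j _; rewrite mulr_ge0 ?subr_ge0 ?V_homo//.
by have /andP[] := q01 j y w.
Qed.

Definition complement q : 'I_M -> R -> Omega -> R := fun j x w => 1 - q j x w.

(** Pointwise, the gains from [q] and from [1 - q] add up to the change of the total valuation. *)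
Lemma integral_gain_complement q y x : jointly_measurable q -> fractional q ->
  \int[P]_w gain (complement q) y x w =
  mean_valuation x - mean_valuation y - \int[P]_w gain q y x w.
Proof.
move=> mq q01; rewrite /mean_valuation -RintegralB//; last 2 first.
- exact: integrable_sum_valuation.
- exact: integrable_sum_valuation.
rewrite -RintegralB//; last 2 first.
- have := integrableB measurableT (integrable_sum_valuation x)
    (integrable_sum_valuation y).
  by apply: eq_integrable.
- exact: integrable_gain.
apply: eq_Rintegral => w _; rewrite /gain /complement -!sumrB.
by apply: eq_bigr => j _; ring.
Qed.

Lemma jointly_measurable_complement : jointly_measurable (complement Q).
Proof. by move=> j; apply: measurable_funB. Qed.

Lemma fractional_complement : fractional (complement Q).
Proof. by move=> j x w; have := Q01 j x w; rewrite /complement; lra. Qed.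

(** The counterpart of [U] for the shares [complement Q]: the part of the mean valuation that [U]
    leaves over. *)
Let S x := mean_valuation x - U x.

Lemma U_homo : {homo U : x y / x <= y}.
Proof.
move=> x y xy; rewrite -subr_ge0; apply: le_trans (U_gain y x).
by apply: Rintegral_ge0 => w _; exact: gain_ge0.
Qed.

(** [U_gain] is subtracted from the change of the mean valuation, which reverses it: a lower bound
    on the gain from [Q] would not do here, whereas its upper bound gives one from below for the
    complement. *)
Lemma surplus_gain x y : \int[P]_w gain (complement Q) y x w >= S x - S y.
Proof. by rewrite integral_gain_complement// /S; have := U_gain x y; lra. Qed.

Lemma surplus_homo : {homo S : x y / x <= y}.
Proof.
move=> x y xy; rewrite -subr_le0; apply: le_trans (surplus_gain x y) _.
have C01 := fractional_complement.
apply: (@le_trans _ _ (\int[P]_w (0 : R))).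
  apply: le_Rintegral => //.
  - by apply: integrable_gain => //; exact: jointly_measurable_complement.
  - exact: integrable0.
  - by move=> w _; exact: gain_le0.
by rewrite Rintegral_cst// mul0r.
Qed.

(** [U] and [S] are both nondecreasing and add up to [mean_valuation], so the increments of [U] are
    at most those of a continuous function in absolute value. *)
Lemma U_continuous : continuous U.
Proof.
move=> x; apply/cvgrPdist_le => e e0.
have /cvgrPdist_le/(_ _ e0) := continuous_mean_valuation (x := x).
apply: filterS => y Ky; apply: le_trans Ky.
have [xy|/ltW yx] := lerP x y.
- have := U_homo xy; have := surplus_homo xy; rewrite /S => h1 h2.
  by rewrite !ler0_norm ?subr_le0//; lra.
- have := U_homo yx; have := surplus_homo yx; rewrite /S => h1 h2.
  by rewrite !ger0_norm ?subr_ge0//; lra.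
Qed.

Lemma surplus_continuous : continuous S.
Proof.
move=> x; apply: cvgB; [exact: continuous_mean_valuation | exact: U_continuous].
Qed.

Lemma integral_gainM q y x (k : R) : jointly_measurable q -> fractional q ->
  \int[P]_w (gain q y x w * k) = (\int[P]_w gain q y x w) * k.
Proof. by move=> mq q01; rewrite RintegralZr//; exact: integrable_gain. Qed.

(** * The two rent bounds and their equality *)

Lemma rent_le_utility a b : a <= b ->
  (\int[P]_w \int[mu]_(x in `[a, b]) (\sum_(j < M) Q j x w * DV j x w)%:E
    <= (U b - U a)%:E)%E.
Proof.
move=> ab; apply: (@integral_marginal_gain_le Q U harmonic) => //.
- exact: U_continuous.
- exact: U_homo.
- exact: cvg_harmonic.
- by move=> n; rewrite /harmonic/= invr_eq0 pnatr_eq0.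
- move=> x n; rewrite integral_gainM// ler_wpM2r//.
  by rewrite invr_ge0 /harmonic/= invr_ge0.
Qed.

(** [surplus_gain] bounds the gain from below; dividing by a negative increment turns this into the
    upper bound that the Fatou argument requires. *)
Lemma complement_rent_le_surplus a b : a <= b ->
  (\int[P]_w \int[mu]_(x in `[a, b])
      (\sum_(j < M) complement Q j x w * DV j x w)%:E <= (S b - S a)%:E)%E.
Proof.
have mC := jointly_measurable_complement.
have C01 := fractional_complement.
move=> ab.
apply: (@integral_marginal_gain_le (complement Q) S (fun n => - harmonic n)) => //.
- exact: surplus_continuous.
- exact: surplus_homo.
- by rewrite -oppr0; apply: cvgN; exact: cvg_harmonic.
- by move=> n; rewrite /harmonic/= oppr_eq0 invr_eq0 pnatr_eq0.
- move=> x n; rewrite integral_gainM// ler_wnM2r//; last exact: surplus_gain.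
  by rewrite invr_le0 oppr_le0 /harmonic/= invr_ge0.
Qed.

(** A concave function lies below its tangents, so each forward difference quotient is at most the
    derivative; integrating and letting the increment tend to 0 gives the bound. *)
Lemma sum_valuation_le_integral a b w : lo <= a -> a < b -> b <= hi ->
  ((\sum_(j < M) V j b w - \sum_(j < M) V j a w)%:E <=
    \int[mu]_(x in `[a, b]) (\sum_(j < M) DV j x w)%:E)%E.
Proof.
move=> loa ab bhi; pose T x := \sum_(j < M) V j x w.
have mD : measurable_fun setT (fun x => \sum_(j < M) DV j x w).
  apply: measurable_sum => j.
  exact: (measurableT_comp (mDV j) (@pair2_measurable _ _ _ _ w)).
have cT : continuous T.
  move=> x; apply: cvg_big => [|j _]; last exact: V_continuous.
  by move=> z; exact: add_continuous.
have h0 n : harmonic n != 0 :> R by rewrite /harmonic/= invr_eq0 pnatr_eq0.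
have := integral_diff_quotient_cvg ab cT cvg_harmonic h0.
move/cvg_lim => <- //; apply: lime_le.
  apply/cvg_ex; eexists; exact: (integral_diff_quotient_cvg ab cT cvg_harmonic h0).
apply: nearW => n.
have mq : measurable_fun setT (diff_quotient T (harmonic n)).
  by apply: continuous_measurable_fun; exact: continuous_diff_quotient.
(* The endpoints are removed because the tangent inequality is available at interior types only:
   [DV] is 0 at [lo] and [hi]. *)
rewrite integral_itv_bndoo; last exact/measurable_EFinP/measurable_funTS.
rewrite [leRHS]integral_itv_bndoo; last exact/measurable_EFinP/measurable_funTS.
apply: ge0_le_integral => //.
- move=> x _; rewrite lee_fin diff_quotient_ge0// => y z yz.
  by apply: ler_sum => j _; exact: V_homo.
- exact/measurable_EFinP/measurable_funTS.
- exact/measurable_EFinP/measurable_funTS.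
move=> x /=; rewrite in_itv/= => /andP[ax xb]; rewrite lee_fin.
have hn : 0 < harmonic n :> R by rewrite /harmonic/= invr_gt0.
rewrite /diff_quotient ler_pdivrMr// /T -sumrB mulr_suml; apply: ler_sum => j _.
have := @V_tangent j x (x + harmonic n) w.
by rewrite addrAC subrr add0r; apply; lra.
Qed.

Lemma envelope a b : lo <= a -> a <= b -> b <= hi ->
  (\int[P]_w \int[mu]_(x in `[a, b]) (\sum_(j < M) Q j x w * DV j x w)%:E
    = (U b - U a)%:E)%E.
Proof.
move=> loa; rewrite le_eqVlt => /predU1P[<- _|ab bhi].
  under eq_integral do rewrite set_itv1 integral_set1.
  by rewrite integral0 subrr.
have rent_joint q : jointly_measurable q -> fractional q ->
  let f z := (\sum_(j < M) q j z.1 z.2 * DV j z.1 z.2)%:E in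
  measurable_fun setT f /\ (forall z, 0 <= f z)%E.
  move=> mq q01; split.
    by apply/measurable_EFinP; apply: measurable_sum => j; exact: measurable_funM.
  move=> z; rewrite lee_fin; apply: sumr_ge0 => j _; rewrite mulr_ge0//.
  by have /andP[] := q01 j z.1 z.2.
have [mf f0] := rent_joint Q mQ Q01.
have [mg g0] := rent_joint _ jointly_measurable_complement fractional_complement.
have [_ /= mF] := @tonelli_within _ _ _ _ _ mu P _ _ (measurable_itv `[a, b]) mf f0.
have [_ /= mG] := @tonelli_within _ _ _ _ _ mu P _ _ (measurable_itv `[a, b]) mg g0.
have ubQ := rent_le_utility (ltW ab).
have ubC := complement_rent_le_surplus (ltW ab).
apply/eqP; rewrite eq_le ubQ/=.
(* The shares [Q] and [complement Q] add up to 1, so the two rents together integrate the whole of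
   [DV], and concavity applies for each [w]. *)
have lb : ((mean_valuation b - mean_valuation a)%:E <=
  \int[P]_w \int[mu]_(x in `[a, b]) (\sum_(j < M) Q j x w * DV j x w)%:E +
  \int[P]_w \int[mu]_(x in `[a, b])
     (\sum_(j < M) complement Q j x w * DV j x w)%:E)%E.
  rewrite /mean_valuation -RintegralB//; last 2 first.
  - exact: integrable_sum_valuation.
  - exact: integrable_sum_valuation.
  rewrite -ge0_integralD//; last 2 first.
  - by move=> w _; apply: integral_ge0 => x _; exact: (f0 (x, w)).
  - by move=> w _; apply: integral_ge0 => x _; exact: (g0 (x, w)).
  rewrite fineK; last first.
    apply: integrable_fin_num => //.
    have := integrableB measurableT (integrable_sum_valuation b)
      (integrable_sum_valuation a).
    by apply: eq_integrable.
  apply: ge0_le_integral => //.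
  - move=> w _; rewrite lee_fin subr_ge0; apply: ler_sum => j _.
    by apply: V_homo; exact: ltW.
  - apply/measurable_EFinP; apply: measurable_funB; apply: measurable_sum => j;
      exact: jointly_measurable_section.
  - exact: emeasurable_funD.
  move=> w _; apply: le_trans (sum_valuation_le_integral w loa ab bhi) _.
  rewrite -ge0_integralD//; last 4 first.
  - by move=> x _; exact: (f0 (x, w)).
  - apply: measurable_funTS; exact: (measurableT_comp mf (@pair2_measurable _ _ _ _ w)).
  - by move=> x _; exact: (g0 (x, w)).
  - apply: measurable_funTS; exact: (measurableT_comp mg (@pair2_measurable _ _ _ _ w)).
  rewrite le_eqVlt; apply/orP; left; apply/eqP; apply: eq_integral => x _.
  rewrite -EFinD -big_split/=; congr EFin; apply: eq_bigr => j _.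
  by rewrite /complement; ring.
(* Nonnegativity and the upper bounds make both rents finite; what remains is linear arithmetic over
   the reals. *)
move: ubQ ubC lb.
have : (0 <= \int[P]_w \int[mu]_(x in `[a, b]) (\sum_(j < M) Q j x w * DV j x w)%:E)%E.
  by apply: integral_ge0 => w _; apply: integral_ge0 => x _; exact: (f0 (x, w)).
have : (0 <= \int[P]_w \int[mu]_(x in `[a, b])
     (\sum_(j < M) complement Q j x w * DV j x w)%:E)%E.
  by apply: integral_ge0 => w _; apply: integral_ge0 => x _; exact: (g0 (x, w)).
case: (integral P _ _) => [r| |] //; case: (integral P _ _) => [s| |] //.
by rewrite -EFinD !lee_fin /S; lra.
Qed.

End Envelope.

(** * Clamping to an interval, and tangents of concave functions *)

Lemma cvgn_ge {R : realType} (u : R^nat) (x l : R) :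
  u @ \oo --> l -> (forall n, x <= u n) -> x <= l.
Proof.
move=> ul xu; rewrite -(cvg_lim _ ul)//; apply: limr_ge; first by apply/cvg_ex; exists l.
exact: nearW.
Qed.

Section Clamp.
Context {R : realType} (a b : R) (ab : a <= b).
Implicit Types (x : R) (f : R -> R).

Definition clamp x : R := Num.max a (Num.min b x).

Lemma clamp_itv x : clamp x \in `[a, b].
Proof. by rewrite in_itv/= /clamp le_max lexx ge_max ab ge_min lexx. Qed.

Lemma clamp_id x : x \in `[a, b] -> clamp x = x.
Proof.
by rewrite in_itv/= => /andP[ax xb]; rewrite /clamp (min_idPr xb) (max_idPr ax).
Qed.

Lemma clamp_homo : {homo clamp : x y / x <= y}.
Proof.
by move=> x y xy; rewrite /clamp ge_max !le_max lexx/= le_min !ge_min lexx xy !orbT.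
Qed.

Lemma clamp_continuous : continuous clamp.
Proof.
move=> x; apply: continuous_max; first exact: cvg_cst.
by apply: continuous_min; [exact: cvg_cst | exact: cvg_id].
Qed.

(** [clamp] is continuous and never leaves the interval, so continuity of [f] relative to the
    interval is enough. *)
Lemma continuous_comp_clamp f :
  {within `[a, b], continuous f} -> continuous (f \o clamp).
Proof.
move=> /subspace_continuousP fc x.
apply: cvg_comp (fc _ (clamp_itv x)) => A /= HA.
have HAx : \forall y \near x, `[a, b]%classic (clamp y) -> A (clamp y).
  exact: (@clamp_continuous x _ HA).
by apply: filterS HAx => y; apply; exact: clamp_itv.
Qed.

(** Concavity on the segment from [x] to [y] gives [f y - f x <= (f (x + s * (y - x)) - f x) / s]
    for [0 < s <= 1]; the right side tends to the tangent term as [s] tends to 0. *)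
Lemma concave_tangent f x y : a < x < b -> y \in `[a, b] ->
  derivable f x 1 ->
  convex_function (`[a, b]%classic : set R^o) (fun x => - f x) ->
  f y - f x <= derive1 f x * (y - x).
Proof.
move=> /andP[ax xb] yI dfx cf; have [->|yx] := eqVneq y x.
  by rewrite !subrr mulr0.
have yx0 : y - x != 0 by rewrite subr_eq0.
(* Scaled by [y - x], the increment makes [x + h n] the convex combination of [y] and [x] with
   weight [harmonic n] on [y], whichever side [y] is on. *)
pose h n : R := harmonic n * (y - x).
have h0 : h @ \oo --> (0 : R).
  by rewrite -(mul0r (y - x)); apply: cvgMr_tmp; exact: cvg_harmonic.
have hn0 n : h n != 0 by rewrite mulf_neq0// invr_eq0 pnatr_eq0.
have qc : diff_quotient f (h n) x * (y - x) @[n --> \oo] -->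
    derive1 f x * (y - x).
  by apply: cvgMr_tmp; exact: cvg_diff_quotient.
apply: (cvgn_ge qc) => n.
have t0 : 0 < harmonic n :> R by rewrite /harmonic/= invr_gt0.
have t1 : harmonic n <= 1 :> R by rewrite /harmonic/= invf_le1// ler1n.
have xI : x \in `[a, b] by rewrite in_itv/= !ltW.
have : h n = harmonic n * (y - x) by [].
move: (harmonic n : R) (h n) t0 t1 => s hn t0 t1 hnE.
have := cf (Itv01 (ltW t0) t1) y x; rewrite !inE => /(_ yI xI).
rewrite [X in f X](_ : _ = x + hn); last first.
  by transitivity (s * y + (1 - s) * x); [by [] | rewrite hnE; ring].
rewrite convRE/= /unstable.onem => cc.
rewrite /diff_quotient.
have -> : (f (x + hn) - f x) / hn * (y - x) = (f (x + hn) - f x) / s.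
  by rewrite hnE; field; rewrite yx0 gt_eqF.
rewrite ler_pdivlMr//; lra.
Qed.

End Clamp.

(** * One user of the auction as an instance of the envelope setting *)

Section SingleUser.
Context {R : realType} {N M G : nat} (m : 'I_G -> nat) (lo hi : 'I_N -> R)
  {d : measure_display} {Omega : measurableType d} (P : probability Omega R)
  (tau : 'I_N -> {RV P >-> R})
  (htau : forall i w, tau i w \in `[lo i, hi i])
  (v : 'I_N -> 'I_M -> N.-tuple R -> R)
  (hv : valuation_profile lo hi v) (hvreg : regular_valuation tau lo hi v)
  (h l : 'I_N -> R -> R)
  (p : 'I_N -> 'I_M -> N.-tuple R -> R) (hp : allocation lo hi p)
  (c : 'I_N -> R -> R) (i : 'I_N) (lohi : lo i <= hi i).
Notation mu := (@lebesgue_measure R).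
(* Clamping the own type to [lo i, hi i] makes the difference quotients of the
   valuations available at every real point. *)
Let cl := clamp (lo i) (hi i).
Let profile := type_profile tau.

Let V (j : 'I_M) (x : R) (w : Omega) : R :=
  own_valuation v i j (profile w) (cl x).
Let Q (j : 'I_M) (x : R) (w : Omega) : R :=
  p i j (with_type i (cl x) (profile w)).
(* The derivative at the two endpoints is a junk value, hence the case split. *)
Let DV (j : 'I_M) (x : R) (w : Omega) : R :=
  if lo i < x < hi i then own_derivative v i j (profile w) x else 0.

Let space_profile w : type_space lo hi (profile w).
Proof. by move=> k /=; rewrite tnth_mktuple; exact: htau. Qed.

Let space_with_type x t : x \in `[lo i, hi i] -> type_space lo hi t ->
  type_space lo hi (with_type i x t).
Proof.
move=> xI ht k /=; rewrite tnth_mktuple.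
by case: eqVneq => [->|] //; exact: ht.
Qed.

Let cl_itv x : cl x \in `[lo i, hi i].
Proof. exact: clamp_itv. Qed.

Let space_cl x w : type_space lo hi (with_type i (cl x) (profile w)).
Proof. exact: space_with_type. Qed.

Lemma measurable_type_space : measurable (type_space lo hi).
Proof.
have -> : type_space lo hi =
    (\bigcap_(k in [set: 'I_N])
      ((fun t : N.-tuple R => tnth t k) @^-1` `[lo k, hi k]))%classic.
  by apply/seteqP; split => t ht k; [move=> _; exact: (ht k) | exact: (ht k I)].
apply: fin_bigcap_measurable => // k _.
by rewrite -[X in measurable X]setTI; exact: measurable_tnth.
Qed.

(** The clamped profile stays in [type_space], the only set on which [g] is known to be
    measurable. *)
Lemma jointly_measurable_type_function (g : 'I_M -> N.-tuple R -> R) :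
  (forall j, measurable_fun (type_space lo hi) (g j)) ->
  jointly_measurable (fun j x w => g j (with_type i (cl x) (profile w))).
Proof.
move=> mg j; apply: (@measurable_comp _ _ _ _ _ _ (type_space lo hi) (g j) setT
  (fun z : R * Omega => with_type i (cl z.1) (profile z.2))) => //.
- exact: measurable_type_space.
- by move=> _ [z _ <-]; exact: space_cl.
apply/measurable_fun_tnthP => k; rewrite /comp.
have [->|ki] := eqVneq k i.
  under eq_fun do rewrite tnth_mktuple eqxx.
  apply: (measurableT_comp _ measurable_fst).
  by apply: continuous_measurable_fun; exact: clamp_continuous.
under eq_fun do rewrite tnth_mktuple (negbTE ki) tnth_mktuple.
exact: measurableT_comp.
Qed.

Let mV : jointly_measurable V.
Proof.
apply: (@jointly_measurable_type_function (v i)) => j.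
exact: valuation_measurable hvreg _ _.
Qed.

Let mQ : jointly_measurable Q.
Proof.
apply: (@jointly_measurable_type_function (p i)) => j.
exact: allocation_measurable hp _ _.
Qed.

Lemma allocation_fraction j t : type_space lo hi t -> 0 <= p i j t <= 1.
Proof.
move=> ht; rewrite (allocation_ge0 hp)//=.
apply: le_trans (allocation_le1 hp j ht).
rewrite (bigD1 i)//= lerDl; apply: sumr_ge0 => k _; exact: allocation_ge0 hp _ _ _ ht.
Qed.

Let Q01 : fractional Q.
Proof. by move=> j x w; exact: allocation_fraction. Qed.

Let V_ge0 j x w : 0 <= V j x w.
Proof. by rewrite ltW// /V /own_valuation (valuation_gt0 hv). Qed.

Let V_homo j w : {homo (fun x => V j x w) : x y / x <= y}.
Proof.
move=> x y xy; apply: (valuation_nondecreasing hv) => //.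
exact: clamp_homo.
Qed.

Let V_le j x w : V j x w <= V j (hi i) w.
Proof.
apply: (valuation_nondecreasing hv) => //.
rewrite {2}/cl clamp_id; first by have := cl_itv x; rewrite in_itv => /andP[].
by rewrite in_itv/= lexx lohi.
Qed.

Let V_continuous j w : continuous (fun x => V j x w).
Proof.
apply: continuous_comp_clamp => //; apply: derivable_oo_LRcontinuous_within.
exact: valuation_derivable hvreg _ _ _ _.
Qed.

Let V_integrable j x : P.-integrable setT (EFin \o V j x).
Proof. exact: valuation_integrable hvreg _ _ _ _. Qed.

Let near_V j x w : lo i < x < hi i ->
  \forall y \near x, own_valuation v i j (profile w) y = V j y w.
Proof.
move=> xI; have xI' : x \in `]lo i, hi i[ by rewrite in_itv.
apply: filterS (near_in_itvoo xI') => y yI.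
by rewrite /V /cl clamp_id//; exact: subset_itv_oo_cc.
Qed.

Let own_derivable j x w : lo i < x < hi i ->
  derivable (own_valuation v i j (profile w)) x 1.
Proof.
move=> xI; have [+ _ _] := valuation_derivable hvreg i j (space_profile w).
by apply; rewrite in_itv.
Qed.

Let V_derivable j x w : lo i < x < hi i -> derivable (fun y => V j y w) x 1.
Proof.
move=> xI; apply: (@near_eq_derivable _ _ _ (own_valuation v i j (profile w))).
  exact: near_V.
exact: own_derivable.
Qed.

Let DV_derive j x w : lo i < x < hi i -> DV j x w = derive1 (fun y => V j y w) x.
Proof.
move=> xI; rewrite /DV xI /own_derivative !derive1E; apply: near_eq_derive.
exact: near_V.
Qed.

Let DV_out j x w : ~~ (lo i < x < hi i) -> DV j x w = 0.
Proof. by rewrite /DV => /negbTE ->. Qed.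

Let harmonic_neq0 n : harmonic n != 0 :> R.
Proof. by rewrite invr_eq0 pnatr_eq0. Qed.

Let DV_ge0 j x w : 0 <= DV j x w.
Proof.
have [xI|/DV_out->//] := boolP (lo i < x < hi i).
rewrite DV_derive//.
have := cvg_diff_quotient (@V_derivable j x w xI) cvg_harmonic harmonic_neq0.
move/cvgn_ge; apply => n; apply: diff_quotient_ge0.
exact: V_homo.
Qed.

(** Beyond [hi] the clamped valuation is constant while the tangent does not decrease, so the
    inequality at [cl y <= y] suffices. *)
Let V_tangent j x y w : lo i < x < hi i -> x <= y ->
  V j y w - V j x w <= DV j x w * (y - x).
Proof.
move=> xI xy; have /andP[lx xh] := xI.
have clx : cl x = x by rewrite /cl clamp_id// in_itv/= !ltW.
apply: (@le_trans _ _ (DV j x w * (cl y - x))); last first.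
  apply: ler_wpM2l; first exact: DV_ge0.
  rewrite lerD2r /cl /clamp ge_max ge_min lexx orbT andbT.
  by rewrite (le_trans (ltW lx)).
rewrite /V clx /DV xI; apply: (@concave_tangent _ (lo i) (hi i)) => //.
  exact: own_derivable.
exact: valuation_concave hv _ _ _ _.
Qed.

(** On the open strip [DV] is a pointwise limit of jointly measurable difference quotients;
    elsewhere it is 0. *)
Let mDV : jointly_measurable DV.
Proof.
move=> j; pose A := `]lo i, hi i[%classic `*` @setT Omega.
have mA : measurable A by apply: measurableX.
have -> : (fun z : R * Omega => DV j z.1 z.2) =
    (fun z => derive1 (fun y => V j y z.2) z.1) \_ A.
  apply/funext => z; rewrite patchE; case: ifPn => zA.
    by apply: DV_derive; move: zA; rewrite inE => -[/=]; rewrite in_itv.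
  apply: DV_out; apply: contra zA => zI; apply/mem_set.
  exact: (conj zI I).
apply/(measurable_restrictT _ mA).
apply: (@measurable_fun_cvg _ _ _ _
  (fun n z => diff_quotient (fun y => V j y z.2) (harmonic n) z.1)).
  move=> n; apply: measurable_funTS; apply: measurable_funM => //.
  apply: measurable_funB; last exact: mV.
  have mshift : measurable_fun setT (fun z : R * Omega => (z.1 + harmonic n, z.2)).
    apply: measurable_fun_pair => //; exact: measurable_funD.
  exact: (measurableT_comp (mV j) mshift).
move=> z [/=]; rewrite in_itv/= => zI _.
apply: cvg_diff_quotient => //; [exact: V_derivable | exact: cvg_harmonic].
Qed.

Let V_integral_DV j w a b : a <= b ->
  (\int[mu]_(x in `[a, b]) (DV j x w)%:E <= (V j b w - V j a w)%:E)%E.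
Proof.
move=> ab; apply: (@integral_limn_einf_diff_quotient _ (fun x => V j x w) harmonic) => //.
- exact: cvg_harmonic.
- apply/measurable_EFinP/measurable_funTS.
  exact: (measurableT_comp (mDV j) (@pair2_measurable _ _ _ _ w)).
- by move=> x; rewrite lee_fin.
move=> x _; have [xI|xI] := boolP (lo i < x < hi i); last first.
  rewrite DV_out//; apply: limn_einf_ge0 => n.
  by rewrite lee_fin diff_quotient_ge0//; exact: V_homo.
rewrite (cvg_limn_einf_sup (l := (DV j x w)%:E) _).1//.
apply/fine_cvgP; split; first exact: nearW.
rewrite DV_derive//; apply: cvg_diff_quotient => //; last exact: cvg_harmonic.
exact: V_derivable.
Qed.

(** * Information rents as iterated extended-real integrals *)

Let rent a b : \bar R :=
  (\int[P]_w \int[mu]_(x in `[a, b]) (\sum_(j < M) Q j x w * DV j x w)%:E)%E.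

(** [own_derivative] and [DV] agree on the open interval, and the endpoints are a null set. *)
Let sum_oriented_integral a b w : lo i <= a -> a <= b -> b <= hi i ->
  (\sum_(j < M) oriented_integral a b
     (fun x => own_derivative v i j (profile w) x *
               p i j (with_type i x (profile w))))%:E =
  (\int[mu]_(x in `[a, b]) (\sum_(j < M) Q j x w * DV j x w)%:E)%E.
Proof.
move=> la ab bh.
have mQDV j : measurable_fun setT (fun x => Q j x w * DV j x w).
  apply: measurable_funM.
    exact: (measurableT_comp (mQ j) (@pair2_measurable _ _ _ _ w)).
  exact: (measurableT_comp (mDV j) (@pair2_measurable _ _ _ _ w)).
have QDV0 j x : 0 <= Q j x w * DV j x w.
  by rewrite mulr_ge0//; have /andP[] := Q01 j x w.
under [in RHS]eq_integral do rewrite -sumEFin.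
rewrite ge0_integral_sum//; last 2 first.
- by move=> j; apply/measurable_EFinP; exact: (measurable_funTS (mQDV j)).
- by move=> j x _; rewrite lee_fin.
rewrite -sumEFin; apply: eq_bigr => j _; rewrite /oriented_integral ab /Rintegral.
have QDVE : {in `]a, b[, (fun x => Q j x w * DV j x w) =1
    (fun x => own_derivative v i j (profile w) x * p i j (with_type i x (profile w)))}.
  move=> x; rewrite in_itv/= => /andP[ax xb].
  have xI : lo i < x < hi i by rewrite (le_lt_trans la)//= (lt_le_trans xb).
  rewrite /Q /DV xI mulrC /cl clamp_id// in_itv/=; lra.
have mown : measurable_fun `]a, b[ (fun x =>
    own_derivative v i j (profile w) x * p i j (with_type i x (profile w))).
  apply: (@eq_measurable_fun _ _ _ _ _ (fun x => Q j x w * DV j x w)).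
    by move=> x; rewrite inE/= => /QDVE.
  exact: (measurable_funTS (mQDV j)).
have -> : (\int[mu]_(x in `[a, b]) (own_derivative v i j (profile w) x *
    p i j (with_type i x (profile w)))%:E =
    \int[mu]_(x in `[a, b]) (Q j x w * DV j x w)%:E)%E.
  apply: eq_integral_itv_bounded => //; first exact: (measurable_funTS (mQDV j)).
  by move=> x /QDVE ->.
(* A real-valued integral is the [fine] of the extended one, so finiteness has to be shown: shares
   are at most 1, and the integral of [DV] is at most [V j b w - V j a w]. *)
rewrite fineK//; apply/fin_numPlt/andP; split.
  by apply: lt_le_trans (integral_ge0 _ _) => // x _; rewrite lee_fin.
apply: le_lt_trans (ltry (V j b w - V j a w)).
apply: le_trans (V_integral_DV j w ab).
apply: ge0_le_integral => //.
- by move=> x _; rewrite lee_fin.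
- by apply/measurable_EFinP; exact: (measurable_funTS (mQDV j)).
- apply/measurable_EFinP/measurable_funTS.
  exact: (measurableT_comp (mDV j) (@pair2_measurable _ _ _ _ w)).
move=> x _; rewrite lee_fin ler_piMl//.
by have /andP[] := Q01 j x w.
Qed.

Let rent_ge0 a b : (0 <= rent a b)%E.
Proof.
apply: integral_ge0 => w _; apply: integral_ge0 => x _; rewrite lee_fin.
by apply: sumr_ge0 => j _; rewrite mulr_ge0//; have /andP[] := Q01 j x w.
Qed.

Let rent_split a b k : a <= b -> b <= k -> rent a k = (rent a b + rent b k)%E.
Proof.
move=> ab bk; apply: (@integral_itv_split _ _ _ P
  (fun z => (\sum_(j < M) Q j z.1 z.2 * DV j z.1 z.2)%:E)) => //.
  by apply/measurable_EFinP; apply: measurable_sum => j; exact: measurable_funM.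
move=> z; rewrite lee_fin; apply: sumr_ge0 => j _; rewrite mulr_ge0//.
by have /andP[] := Q01 j z.1 z.2.
Qed.

Let expected_information_rentE a b : lo i <= a -> a <= b -> b <= hi i ->
  expected_information_rent tau v p i a b = rent a b.
Proof.
move=> la ab bh; rewrite /expected_information_rent /E_others unlock.
by apply: eq_integral => w _; rewrite sum_oriented_integral.
Qed.

Let expected_information_rentN a b : lo i <= a -> a <= b -> b <= hi i ->
  expected_information_rent tau v p i b a = (- rent a b)%E.
Proof.
(* For equal bounds [oriented_integral] takes its unsigned branch, and both sides are 0. *)
move=> la; rewrite le_eqVlt => /predU1P[<-|ab] bh.
  rewrite expected_information_rentE// /rent.
  under eq_integral do rewrite set_itv1 integral_set1.
  by rewrite integral0 oppe0.
rewrite /rent -integral_ge0N; last first.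
  move=> w _; apply: integral_ge0 => x _; rewrite lee_fin.
  by apply: sumr_ge0 => j _; rewrite mulr_ge0//; have /andP[] := Q01 j x w.
rewrite /expected_information_rent /E_others unlock.
apply: eq_integral => w _; rewrite -sum_oriented_integral ?(ltW ab)//.
rewrite -EFinN -sumrN; congr EFin; apply: eq_bigr => j _.
by rewrite /oriented_integral (ltW ab) lt_geF.
Qed.

(** * Payoffs and the incentive constraints *)

Let premium y w := premium_discount m h l p i (with_type i (cl y) (profile w)).

Let payoff y x w := \sum_(j < M) Q j y w * V j x w + premium y w.

(** For a fixed report the factors are constants, and every sum of shares lies between 0 and [M];
    the premium is thus bounded, hence integrable under a probability. *)
Let integrable_premium y : P.-integrable setT (EFin \o premium y).
Proof.
have mS (D : pred 'I_M) : measurable_fun setT (fun w => \sum_(j < M | D j) Q j y w).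
  under eq_fun do rewrite big_mkcond; apply: measurable_sum => j.
  by case: (D j) => //; exact: jointly_measurable_section.
have S0 (D : pred 'I_M) w : 0 <= \sum_(j < M | D j) Q j y w.
  by apply: sumr_ge0 => j _; have /andP[] := Q01 j y w.
have S1 (D : pred 'I_M) w : \sum_(j < M | D j) Q j y w <= M%:R.
  rewrite -[leRHS]mulr_natl mulr1 -[in leRHS](card_ord M) -sumr_const big_mkcond.
  apply: ler_sum => j _; case: (D j) => //.
  by have /andP[] := Q01 j y w.
have premiumE w : premium y w =
    h i (cl y) * (\prod_(k < G) \sum_(j < M | in_group m k j) Q j y w)
    - l i (cl y) * \sum_(j < M) Q j y w.
  by rewrite /premium /premium_discount tnth_mktuple eqxx.
pose C := `|h i (cl y)| * (\prod_(k < G) M%:R) + `|l i (cl y)| * M%:R : R.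
apply: (@le_integrable _ _ _ P _ measurableT _ (cst C%:E)).
- apply/measurable_EFinP; rewrite (funext premiumE).
  apply: measurable_funB; apply: measurable_funM => //; apply: measurable_prod => k _.
  exact: mS.
- move=> w _; rewrite /= lee_fin premiumE [leRHS]ger0_norm; last first.
    by rewrite addr_ge0// mulr_ge0// prodr_ge0.
  apply: le_trans (ler_normB _ _) _; rewrite !normrM; apply: lerD.
    rewrite ler_wpM2l// ger0_norm; last by apply: prodr_ge0 => k _; exact: S0.
    by apply: ler_prod => k _; rewrite S0 S1.
  by rewrite ler_wpM2l// ger0_norm.
- exact: finite_measure_integrable_cst.
Qed.

Let integrable_payoff y x : P.-integrable setT (EFin \o payoff y x).
Proof.
have iQV j : P.-integrable setT (fun w => (Q j y w * V j x w)%:E).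
  apply: (@le_integrable _ _ _ P _ measurableT _ (EFin \o V j x)) => //.
    apply/measurable_EFinP; apply: measurable_funM;
      exact: jointly_measurable_section.
  move=> w _; have /andP[q0 q1] := Q01 j y w.
  by rewrite /= lee_fin !ger0_norm// ?mulr_ge0// ler_piMl.
have iS : P.-integrable setT (fun w => (\sum_(j < M) Q j y w * V j x w)%:E).
  by under eq_fun do rewrite -sumEFin; apply: integrable_sum.
have := integrableD measurableT iS (integrable_premium y).
by apply: eq_integrable.
Qed.

Let gain_payoff y x w : gain V Q y x w = payoff y x w - payoff y y w.
Proof.
rewrite /payoff opprD addrACA subrr addr0 -sumrB.
by apply: eq_bigr => j _; rewrite mulrBr.
Qed.

Let integral_gain y x : \int[P]_w gain V Q y x w =
  \int[P]_w payoff y x w - \int[P]_w payoff y y w.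
Proof.
by rewrite -RintegralB//; apply: eq_Rintegral => w _; exact: gain_payoff.
Qed.

Let deviation_utilityE x y : x \in `[lo i, hi i] -> y \in `[lo i, hi i] ->
  deviation_utility tau v m h l p c i y x =
    (\int[P]_w payoff y x w - c i y)%:E.
Proof.
move=> xI yI; rewrite /deviation_utility /E_others unlock EFinB; congr (_ - _)%E.
rewrite fineK; last by apply: integrable_fin_num => //; exact: integrable_payoff.
by apply: eq_integral => w _; rewrite /payoff /premium /Q /V /cl !clamp_id.
Qed.

Let expected_gainE x y : x \in `[lo i, hi i] -> y \in `[lo i, hi i] ->
  E_others tau (fun s : N.-tuple R =>
    \sum_(j < M) (v i j (with_type i x s) - v i j (with_type i y s))
       * p i j (with_type i y s)) = (\int[P]_w gain V Q y x w)%:E.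
Proof.
move=> xI yI; rewrite /E_others unlock fineK; last first.
  by apply: integrable_fin_num => //; exact: integrable_gain.
apply: eq_integral => w _; rewrite /gain /Q /V /own_valuation /cl !clamp_id//.
by congr EFin; apply: eq_bigr => j _; rewrite mulrC.
Qed.

(** Clamping extends the utility to all reals, as [envelope] requires. *)
Let U x := \int[P]_w payoff x x w - c i (cl x).

Let utilityE x : x \in `[lo i, hi i] ->
  utility tau v m h l p c i x = (U x)%:E.
Proof. by move=> xI; rewrite /U /cl clamp_id// -deviation_utilityE. Qed.

Let deviation_le_gain x y : x \in `[lo i, hi i] -> y \in `[lo i, hi i] ->
  (deviation_utility tau v m h l p c i y x <= utility tau v m h l p c i x)%E =
  (\int[P]_w gain V Q y x w <= U x - U y).
Proof.
move=> xI yI; rewrite utilityE// deviation_utilityE// lee_fin integral_gain.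
rewrite [U y]/U /cl clamp_id//; apply/idP/idP; lra.
Qed.

(** Incentive constraints at clamped types yield the gain inequality at all real points, so
    [envelope] gives condition (2) between any two types, not only from [lo i]. *)
Let rent_eq_utility_gap :
  (forall x y, x \in `[lo i, hi i] -> y \in `[lo i, hi i] ->
    (deviation_utility tau v m h l p c i y x <= utility tau v m h l p c i x)%E) ->
  forall x y, x \in `[lo i, hi i] -> y \in `[lo i, hi i] ->
    [/\ expected_information_rent tau v p i y x = (U x - U y)%:E &
       \int[P]_w gain V Q y x w <= U x - U y].
Proof.
move=> ic x y xI yI; split; last by rewrite -deviation_le_gain// ic.
have ug z t : \int[P]_w gain V Q t z w <= U z - U t.
  have := ic (cl z) (cl t) (cl_itv z) (cl_itv t).
  rewrite deviation_le_gain// /U /gain /payoff /premium /Q /V.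
  by rewrite /cl !(clamp_id (clamp_itv lohi _)).
have env := @envelope _ _ _ P _ (lo i) (hi i) V DV Q U.
move: xI yI; rewrite !in_itv/= => /andP[lx xh] /andP[ly yh].
have [xy|/ltW yx] := lerP x y.
  by rewrite expected_information_rentN// /rent env// -EFinN opprB.
by rewrite expected_information_rentE// /rent env.
Qed.

(** Condition (2) starts every rent at [lo i]; [rent_split] subtracts two such rents, which are
    finite because they equal utility gaps. *)
Let rent_additive x y :
  (forall z, z \in `[lo i, hi i] -> utility tau v m h l p c i z =
    utility tau v m h l p c i (lo i) + expected_information_rent tau v p i (lo i) z)%E ->
  x \in `[lo i, hi i] -> y \in `[lo i, hi i] ->
  expected_information_rent tau v p i y x = (U x - U y)%:E.
Proof.
have loI : lo i \in `[lo i, hi i] by rewrite in_itv/= lexx lohi.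
move=> uE xI yI.
have rE z : z \in `[lo i, hi i] -> rent (lo i) z = (U z - U (lo i))%:E.
  move=> zI; have := uE z zI; rewrite !utilityE//.
  move: zI; rewrite in_itv/= => /andP[lz zh].
  rewrite expected_information_rentE//; case: (rent _ _) => [r| |] //=.
  by rewrite -EFinD => -[->]; congr EFin; lra.
have gap a b : a \in `[lo i, hi i] -> b \in `[lo i, hi i] -> a <= b ->
    rent a b = (U b - U a)%:E.
  move=> aI bI ab; have := rE b bI; rewrite (@rent_split _ a); last first.
  - by [].
  - by move: aI; rewrite in_itv => /andP[].
  rewrite rE//; case: (rent _ _) => [r| |] //=.
  by rewrite -EFinD => -[rb]; congr EFin; lra.
have := (xI, yI); rewrite !in_itv/= => -[/andP[lx xh] /andP[ly yh]].
have [xy|/ltW yx] := lerP x y.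
  by rewrite expected_information_rentN// gap// -EFinN opprB.
by rewrite expected_information_rentE// gap.
Qed.

Let expected_information_rent_lo_ge0 x : x \in `[lo i, hi i] ->
  (0 <= expected_information_rent tau v p i (lo i) x)%E.
Proof.
by rewrite in_itv/= => /andP[lx xh]; rewrite expected_information_rentE.
Qed.

(** Conversely, rationality follows from (1), (2) and nonnegative rents, and (3) becomes the
    incentive constraint once (2) turns its rent into a utility gap. *)
Lemma single_user :
  (forall t, t \in `[lo i, hi i] -> (0 <= utility tau v m h l p c i t)%E) /\
  (forall t that, t \in `[lo i, hi i] -> that \in `[lo i, hi i] ->
    (deviation_utility tau v m h l p c i that t <= utility tau v m h l p c i t)%E)
  <->
  (forall t that, t \in `[lo i, hi i] -> that \in `[lo i, hi i] ->
    [/\ (0 <= utility tau v m h l p c i (lo i))%E,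
        utility tau v m h l p c i t =
          (utility tau v m h l p c i (lo i)
           + expected_information_rent tau v p i (lo i) t)%E
      & (E_others tau (fun s : N.-tuple R =>
           (\sum_(j < M) (v i j (with_type i t s) - v i j (with_type i that s))
                        * p i j (with_type i that s))%R)
         <= expected_information_rent tau v p i that t)%E]).
Proof.
have loI : lo i \in `[lo i, hi i] by rewrite in_itv/= lexx lohi.
split=> [[ir ic] t that tI thatI|conds].
  have [lo_t _] := rent_eq_utility_gap ic tI loI.
  have [that_t gain_le] := rent_eq_utility_gap ic tI thatI.
  split; first exact: ir.
    by rewrite lo_t !utilityE// -EFinD addrC subrK.
  by rewrite that_t expected_gainE// lee_fin.
have uE z (zI : z \in `[lo i, hi i]) : utility tau v m h l p c i z =
    (utility tau v m h l p c i (lo i) + expected_information_rent tau v p i (lo i) z)%E.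
  by have [] := conds z z zI zI.
split=> [t tI|t that tI thatI].
  have [u0 -> _] := conds t t tI tI.
  by rewrite adde_ge0// expected_information_rent_lo_ge0.
have [_ _] := conds t that tI thatI.
by rewrite (rent_additive uE tI thatI) expected_gainE// lee_fin deviation_le_gain.
Qed.

End SingleUser.

Theorem proposition1 (R : realType) (N M G : nat)
  (m : 'I_G -> nat) (hM : (\sum_(k < G) m k)%N = M)
  (lo hi : 'I_N -> R)
  (d : measure_display) (Omega : measurableType d) (P : probability Omega R)
  (tau : 'I_N -> {RV P >-> R})
  (htau : forall i w, tau i w \in `[lo i, hi i])
  (F f : 'I_N -> R -> R) (hFf : forall i, has_cdf_pdf (tau i) (F i) (f i))
  (v : 'I_N -> 'I_M -> N.-tuple R -> R)
  (hv : valuation_profile lo hi v) (hvreg : regular_valuation tau lo hi v)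
  (h l : 'I_N -> R -> R)
  (p : 'I_N -> 'I_M -> N.-tuple R -> R) (hp : allocation lo hi p)
  (c : 'I_N -> R -> R) :
  (individually_rational tau lo hi v m h l p c /\
   incentive_compatible tau lo hi v m h l p c)
  <->
  (forall (i : 'I_N) (t that : R),
     t \in `[lo i, hi i] -> that \in `[lo i, hi i] ->
     [/\ (0 <= utility tau v m h l p c i (lo i))%E,
         utility tau v m h l p c i t =
           (utility tau v m h l p c i (lo i)
            + expected_information_rent tau v p i (lo i) t)%E
       & (E_others tau (fun s : N.-tuple R =>
            (\sum_(j < M) (v i j (with_type i t s) - v i j (with_type i that s))
                         * p i j (with_type i that s))%R)
          <= expected_information_rent tau v p i that t)%E]).
Proof.
(* [single_user] asks for a nonempty type interval; any type at hand witnesses it. *)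
have lohi i t : t \in `[lo i, hi i] -> lo i <= hi i.
  by rewrite in_itv => /andP[]; exact: le_trans.
have user i (lohi_i : lo i <= hi i) :=
  single_user m htau hv hvreg h l hp c lohi_i.
split=> [[ir ic] i t that tI|conds].
  apply: (user i (lohi i t tI)).1 tI.
  by split=> [x|x y]; [exact: ir | exact: ic].
split=> [i x xI|i x y xI yI].
  exact: ((user i (lohi i x xI)).2 (conds i)).1.
exact: ((user i (lohi i x xI)).2 (conds i)).2.
Qed.
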